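(* Let $p,k$ be integers with $1\le k<p$, let $\beta_{\min}>0$ and $\gamma\in(0,1]$, and let $$ g_1 := \frac{\log\binom{p}{k}-1}{H(\overline{\psi}_1)-\frac12\log(2\pi e)},\qquad g_2 := \frac{\log(p-k+1)-1}{H(\overline{\psi}_2)-\frac12\log(2\pi e)}, $$ where $$\overline{\psi}_1 := \sum_{\ell=0}^{k}\binom{k}{\ell}\gamma^\ell(1-\gamma)^{k-\ell}\,\phi\left(0,1+\frac{\ell\beta_{\min}^2}{\gamma}\right),\qquad \overline{\psi}_2 := \gamma\,\phi\left(0,1+\frac{\beta_{\min}^2}{\gamma}\right)+(1-\gamma)\,\phi(0,1).$$ (a) In general, $$ g_1\ge\frac{\log\binom{p}{k}-1}{\frac12\log(1+k\beta_{\min}^2)},\qquad g_2\ge\frac{\log(p-k+1)-1}{\frac12\log(1+\beta_{\min}^2)}.$$ (b) If $\gamma k=\tau$ for some constant $\tau$, then $$ g_1\ge\frac{\log\binom{p}{k}-1}{\frac12\tau\log\left(1+\frac{k\beta_{\min}^2}{\tau}\right)+C},\qquad g_2\ge\frac{\log(p-k+1)-1}{\frac12\frac{\tau}{k}\log\left(1+\frac{k\beta_{\min}^2}{\tau}\right)+H_{binary}\left(\frac{\tau}{k}\right)},$$ where $C=\frac12\log\left(2\pi e\left(\tau+\frac1{12}\right)\right)$. (c) If $\gamma k\le1$, then $$ g_1\ge\frac{\log\binom{p}{k}-1}{\frac12\gamma k\log\left(1+\frac{\beta_{\min}^2}{\gamma}\right)+kH_{binary}(\gamma)},\qquad g_2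\ge\frac{\log(p-k+1)-1}{\frac12\gamma\log\left(1+\frac{\beta_{\min}^2}{\gamma}\right)+H_{binary}(\gamma)}.$$
   Context: $\phi(\mu,\sigma^2)$ denotes the Gaussian density on $\mathbb{R}$ with mean $\mu$ and variance $\sigma^2$. $H(\cdot)$ of a density denotes differential entropy, $H(f)=-\int f\log f$. $H_{binary}(\gamma)=-\gamma\log\gamma-(1-\gamma)\log(1-\gamma)$ is the entropy of a Bernoulli($\gamma$) variable. Logarithms are base 2. *)

(* Defs.v *)
From HB Require Import structures.
From mathcomp Require Import all_boot all_order all_algebra.
From mathcomp Require Import all_classical all_reals all_analysis.
Import Order.TTheory GRing.Theory Num.Theory.

Set Implicit Arguments.
Unset Strict Implicit.
Unset Printing Implicit Defensive.

Local Open Scope classical_set_scope.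
Local Open Scope ring_scope.

Definition log2 (R : realType) (x : R) : R := ln x / ln 2.

(* The second parameter is the variance, whereas that of [normal_pdf] is the
   standard deviation. [normal_pdf] is a junk density at standard deviation 0,
   so [v] should be positive; every variance used below is at least 1 when
   gamma is positive. *)
Definition gauss (R : realType) (m v : R) : R -> R :=
  normal_pdf m (Num.sqrt v).

(* The real-valued integral is 0 when the extended one is infinite; f log f is
   integrable for the finite Gaussian mixtures considered below. *)
Definition diff_entropy (R : realType) (f : R -> R) : R :=
  - (\int[lebesgue_measure]_(x in [set: R]) (f x * log2 (f x))).

(* As [ln 0 = 0], this uses the convention 0 log 0 = 0 at the endpoints. *)
Definition H_binary (R : realType) (gamma : R) : R :=
  - (gamma * log2 gamma) - (1 - gamma) * log2 (1 - gamma).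

Definition psi1 (R : realType) (k : nat) (beta gamma : R) : R -> R :=
  fun x => \sum_(0 <= l < k.+1)
    'C(k, l)%:R * gamma ^+ l * (1 - gamma) ^+ (k - l)
    * gauss 0 (1 + l%:R * beta ^+ 2 / gamma) x.

Definition psi2 (R : realType) (beta gamma : R) : R -> R :=
  fun x => gamma * gauss 0 (1 + beta ^+ 2 / gamma) x
           + (1 - gamma) * gauss 0 1 x.

Definition g1 (R : realType) (p k : nat) (beta gamma : R) : R :=
  (log2 'C(p, k)%:R - 1)
  / (diff_entropy (psi1 k beta gamma) - 1 / 2 * log2 (2 * pi * expR 1)).

Definition g2 (R : realType) (p k : nat) (beta gamma : R) : R :=
  (log2 (p - k + 1)%N%:R - 1)
  / (diff_entropy (psi2 beta gamma) - 1 / 2 * log2 (2 * pi * expR 1)).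

(* Main.v *)
Require Import Defs.
From HB Require Import structures.
From mathcomp Require Import all_boot all_order all_algebra.
From mathcomp Require Import all_classical all_reals all_analysis.
From mathcomp Require Import measurable_realfun ring lra.
Import Order.TTheory GRing.Theory Num.Theory.
Import numFieldNormedType.Exports.
Local Open Scope ring_scope.

(** Both psi1 and psi2 are mixtures of centered Gaussians f_l with weights w_l
and variances v_l. Convexity of t ln t gives, pointwise,
  sum_l w_l f_l ln (w_l f_l) <= psi ln psi <= sum_l w_l f_l ln f_l,
so psi ln psi is integrable and the excess h of the entropy of psi over that of
the standard Gaussian lies between sum_l w_l (ln v_l) / 2 > 0 and the same sum
plus the entropy of w; Gibbs' inequality against the Gaussian with the variance
of psi gives h <= ln (sum_l w_l v_l) / 2. For binomial weights, Bernoulli's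
inequality ln (1 + l x) <= l ln (1 + x) bounds the sum, and the entropy of w is
at most that of k independent Bernoulli variables, and at most that of a
Gaussian of variance tau + 1/12, where 1/12 is the variance of a uniform
variable on a unit interval. Since the numerators are nonnegative and h > 0,
upper bounds on h become lower bounds on the quotients. *)

(** The value of a real-valued integral carries information only together with integrability, since
    it is 0 when the extended integral is infinite. Keeping both makes linearity and monotonicity
    unconditional. *)
Definition has_integral {R : realType} (f : R -> R) (c : R) : Prop :=
  integrable lebesgue_measure setT (EFin \o f) /\
  \int[lebesgue_measure]_x f x = c.

(** * Linearity, monotonicity and squeezing of integrals *)

Section HasIntegral.
Context {R : realType}.
Implicit Types f g h : R -> R.

Lemma has_integral_ext f g c : f =1 g -> has_integral f c -> has_integral g c.
Proof. by move=> /funext ->. Qed.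

Lemma has_integral0 : has_integral (fun=> 0 : R) 0.
Proof.
split; first exact: integrable0.
by rewrite /Rintegral integral0_eq.
Qed.

Lemma has_integralD f g a b : has_integral f a -> has_integral g b ->
  has_integral (fun x => f x + g x) (a + b).
Proof.
move=> [fi <-] [gi <-]; split; last by rewrite RintegralD.
exact: integrableD fi gi.
Qed.

Lemma has_integralZ k f a : has_integral f a ->
  has_integral (fun x => k * f x) (k * a).
Proof.
move=> [fi <-]; split; last by rewrite RintegralZl.
exact: integrableZl fi.
Qed.

Lemma has_integralB f g a b : has_integral f a -> has_integral g b ->
  has_integral (fun x => f x - g x) (a - b).
Proof.
move=> fa gb; rewrite -(mulN1r b).
apply: has_integral_ext (has_integralD _ _ _ _ fa (has_integralZ (-1) _ _ gb)).
by move=> x; rewrite mulN1r.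
Qed.

Lemma has_integral_sum n (F : nat -> R -> R) (c : nat -> R) :
  (forall l, (l < n)%N -> has_integral (F l) (c l)) ->
  has_integral (fun x => \sum_(0 <= l < n) F l x) (\sum_(0 <= l < n) c l).
Proof.
elim: n => [|n IH] FC.
  rewrite big_geq//; apply: has_integral_ext has_integral0 => x.
  by rewrite big_geq.
rewrite big_nat_recr//=.
apply: (has_integral_ext (fun x => \sum_(0 <= l < n) F l x + F n x)).
  by move=> x; rewrite big_nat_recr.
apply: has_integralD; last exact: FC.
by apply: IH => l ln; apply: FC; exact: ltnW.
Qed.

Lemma le_has_integral f g a b : has_integral f a -> has_integral g b ->
  (forall x, f x <= g x) -> a <= b.
Proof. by move=> [fi <-] [gi <-] fg; apply: le_Rintegral. Qed.

(** The sum of the absolute values of [f] and [h] dominates [g]. This yields integrability of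
    [psi ln psi] without any tail estimate. *)
Lemma has_integral_squeeze f g h a b : has_integral f a -> has_integral h b ->
  measurable_fun setT g -> (forall x, f x <= g x <= h x) ->
  exists2 c, has_integral g c & a <= c <= b.
Proof.
move=> fa hb mg fgh.
have gi : integrable lebesgue_measure setT (EFin \o g).
  have fhi := integrableD measurableT (integrable_norm fa.1)
    (integrable_norm hb.1).
  apply: (le_integrable measurableT _ _ fhi); first exact/measurable_EFinP.
  move=> x _ /=; rewrite lee_fin; have /andP[fg gh] := fgh x.
  rewrite [leRHS]ger0_norm ?addr_ge0// ler_norml.
  have := ler_norm (h x); have := ler_norm (- f x); rewrite normrN.
  have := normr_ge0 (h x); have := normr_ge0 (f x).
  by move=> *; apply/andP; split; lra.
have gI : has_integral g (\int[lebesgue_measure]_x g x) by [].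
exists (\int[lebesgue_measure]_x g x) => //.
rewrite (le_has_integral _ _ _ _ fa gI) ?(le_has_integral _ _ _ _ gI hb)//.
all: by move=> x; case/andP: (fgh x).
Qed.

End HasIntegral.

(** * Gaussian densities and their second moment *)

Section Gauss.
Context {R : realType}.
Implicit Types m v x : R.

Lemma gaussE m v x : 0 < v -> gauss m v x =
  (Num.sqrt (v * pi *+ 2))^-1 * expR (- (x - m) ^+ 2 / (v *+ 2)).
Proof.
move=> v0; rewrite /gauss normal_pdfE ?gt_eqF ?sqrtr_gt0//.
by rewrite /normal_peak /normal_fun sqr_sqrtr // ltW.
Qed.

Lemma gauss_gt0 m v x : 0 < v -> 0 < gauss m v x.
Proof.
move=> v0; rewrite gaussE// mulr_gt0 ?expR_gt0// invr_gt0 sqrtr_gt0.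
by rewrite pmulrn_lgt0// mulr_gt0// pi_gt0.
Qed.

Lemma ln_gauss m v x : 0 < v ->
  ln (gauss m v x) = - (1 / 2 * ln (2 * pi * v)) - (x - m) ^+ 2 / (2 * v).
Proof.
move=> v0; have pv0 : 0 < v * pi *+ 2 by rewrite pmulrn_lgt0// mulr_gt0// pi_gt0.
rewrite gaussE// [LHS]lnM ?posrE ?expR_gt0 ?invr_gt0 ?sqrtr_gt0//.
rewrite expRK lnV ?posrE ?sqrtr_gt0//.
have -> : 2 * pi * v = Num.sqrt (v * pi *+ 2) ^+ 2.
  by rewrite sqr_sqrtr ?ltW// -mulr_natr; ring.
rewrite lnXn ?sqrtr_gt0//; field.
by rewrite gt_eqF.
Qed.

Lemma measurable_gauss m v : measurable_fun setT (gauss m v).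
Proof. exact: measurable_normal_pdf. Qed.

Lemma has_integral_gauss m v : has_integral (gauss m v) 1.
Proof.
split; first exact: integrable_normal_pdf.
by rewrite /Rintegral integral_normal_pdf.
Qed.

(* The tangent inequality 1 + y <= exp y. Integrated over x, it bounds the second
   moment from above when u > v and from below when u < v; both bounds tend to v
   as u tends to v. *)
Lemma gauss_second_moment_tangent u v x : 0 < u -> 0 < v ->
  (v^-1 - u^-1) / 2 * Num.sqrt v * (x ^+ 2 * gauss 0 v x) <=
  Num.sqrt u * gauss 0 u x - Num.sqrt v * gauss 0 v x.
Proof.
move=> u0 v0; pose c : R := (Num.sqrt (pi *+ 2))^-1.
have c0 : 0 < c by rewrite invr_gt0 sqrtr_gt0 pmulrn_lgt0// pi_gt0.
have gE w : 0 < w -> Num.sqrt w * gauss 0 w x = c * expR (- x ^+ 2 / (w *+ 2)).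
  move=> w0; rewrite gaussE// subr0 -mulrnAr sqrtrM ?ltW// invfM !mulrA divff ?mul1r//.
  by rewrite gt_eqF ?sqrtr_gt0.
rewrite !gE// -mulrBr.
have -> : (v^-1 - u^-1) / 2 * Num.sqrt v * (x ^+ 2 * gauss 0 v x) =
    c * ((v^-1 - u^-1) / 2 * x ^+ 2 * expR (- x ^+ 2 / (v *+ 2))).
  rewrite [RHS]mulrCA -gE//; ring.
rewrite ler_pM2l//.
have -> : - x ^+ 2 / (u *+ 2) =
    - x ^+ 2 / (v *+ 2) + (v^-1 - u^-1) / 2 * x ^+ 2.
  by field; rewrite !gt_eqF.
rewrite expRD -[X in _ <= _ - X]mulr1 -mulrBr mulrC ler_pM2l ?expR_gt0//.
by rewrite lerBrDl expR_ge1Dx.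
Qed.

Lemma gauss_second_moment v : 0 < v ->
  has_integral (fun x => x ^+ 2 * gauss 0 v x) v.
Proof.
move=> v0; pose s := Num.sqrt v.
have s0 : 0 < s by rewrite sqrtr_gt0.
have s2 : s ^+ 2 = v by rewrite sqr_sqrtr ?ltW.
have mg : measurable_fun setT (fun x => x ^+ 2 * gauss 0 v x).
  by apply: measurable_funM (measurable_gauss _ _); exact: measurable_funX.
have difI u := has_integralB _ _ _ _
  (has_integralZ (Num.sqrt u) _ _ (has_integral_gauss 0 u))
  (has_integralZ s _ _ (has_integral_gauss 0 v)).
(* The tangent inequality at [u = 2 * v] gives an integrable majorant, so the second moment is some
   finite [M]. *)
have [M MI /andP[M0 _]] : exists2 c, has_integral (fun x => x ^+ 2 * gauss 0 v x) c &
    0 <= c <= ((v^-1 - (2 * v)^-1) / 2 * s)^-1 *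
              (Num.sqrt (2 * v) * 1 - s * 1).
  have k0 : 0 < (v^-1 - (2 * v)^-1) / 2 * s.
    have -> : (v^-1 - (2 * v)^-1) / 2 = v^-1 / 4 by field; rewrite gt_eqF.
    by rewrite mulr_gt0// divr_gt0// invr_gt0.
  apply: (has_integral_squeeze _ _ _ _ _ has_integral0
    (has_integralZ _ _ _ (difI (2 * v))) mg) => x.
  have g0 := gauss_gt0 0 v x v0.
  apply/andP; split; first by rewrite mulr_ge0 ?sqr_ge0// ltW.
  rewrite ler_pdivlMl//.
  by apply: gauss_second_moment_tangent => //; rewrite mulr_gt0.
suff Mv : M = v by move: MI; rewrite {1}Mv.
(* The integrated tangent inequality at [u = t ^+ 2], multiplied by [2 * s * t ^+ 2] to clear
   denominators. *)
have key t : 0 < t -> M * (t ^+ 2 - s ^+ 2) <= 2 * s * t ^+ 2 * (t - s).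
  move=> t0; have t20 : 0 < t ^+ 2 by rewrite exprn_gt0.
  have := le_has_integral _ _ _ _
    (has_integralZ ((v^-1 - (t ^+ 2)^-1) / 2 * s) _ _ MI) (difI (t ^+ 2))
    (fun x => gauss_second_moment_tangent _ _ x t20 v0).
  rewrite sqrtr_sqr gtr0_norm// !mulr1.
  have c0 : 0 < 2 * s * t ^+ 2 by rewrite !mulr_gt0.
  rewrite -/s -(ler_pM2l c0) -s2; congr (_ <= _); field.
  by rewrite !gt_eqF.
(* At [t = s + e] and [t = s - e] a factor [e] cancels, and its sign gives an upper and a lower
   bound on [M]. They deviate from [s ^+ 2] by about 3/2 [s * e]; the constant 3 absorbs the terms
   in [e ^+ 2]. *)
have M6 e : 0 < e -> e < s -> `|M - v| <= 3 * s * e.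
  move=> e0 es.
  have kp : M * (2 * s + e) <= 2 * s * (s + e) ^+ 2.
    rewrite -(ler_pM2r e0); have := key (s + e) ltac:(lra).
    by congr (_ <= _); ring.
  have km : 2 * s * (s - e) ^+ 2 <= M * (2 * s - e).
    rewrite -(ler_pM2r e0) -lerN2; have := key (s - e) ltac:(lra).
    by congr (_ <= _); ring.
  have M0e : 0 <= M * e by rewrite mulr_ge0// ltW.
  have se0 : 0 < s * e by rewrite mulr_gt0.
  have ee : e * e <= s * e by rewrite ler_pM2r// ltW.
  have see : s * (e * e) <= s * (s * e) by rewrite ler_pM2l.
  have see0 : 0 <= s * (e * e) by rewrite ltW// !mulr_gt0.
  have s20 : 0 < 2 * s by rewrite mulr_gt0.
  by rewrite ler_norml -s2; apply/andP; split; rewrite -(ler_pM2l s20); nra.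
apply/eqP; rewrite -subr_eq0 -normr_le0; apply/ler_addgt0Pr => e e0.
rewrite add0r; pose d := Num.min (s / 2) (e / (3 * s)).
have d0 : 0 < d by rewrite /d lt_min !divr_gt0 ?mulr_gt0.
have ds : d < s by rewrite /d gt_min; apply/orP; left; lra.
apply: le_trans (M6 d d0 ds) _.
rewrite mulrC -ler_pdivlMr ?mulr_gt0// /d ge_min; apply/orP; right.
exact: lexx.
Qed.

End Gauss.

(** This is [ln (1 + y) <= y] at [y = b / a - 1], multiplied by [a]. The case [a = 0] is included
    because binomial weights vanish when gamma is 1. *)
Lemma xlnx_tangent {R : realType} (a b : R) : 0 <= a -> 0 < b ->
  a * ln b + (a - b) <= a * ln a.
Proof.
rewrite le_eqVlt => /predU1P[<- b0|a0 b0]; first by lra.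
have ba0 : 0 < b / a by rewrite divr_gt0.
have := @le_ln1Dx R (b / a - 1) ltac:(lra).
rewrite addrC subrK ln_div ?posrE// -(ler_pM2l a0).
by rewrite !mulrBr mulr1 mulrCA divff ?gt_eqF// mulr1; lra.
Qed.

Lemma xlnx_mul {R : realType} (a b : R) : 0 <= a -> 0 < b ->
  a * b * ln (a * b) = a * ln a * b + a * (b * ln b).
Proof.
rewrite le_eqVlt => /predU1P[<- b0|a0 b0]; first by rewrite !mul0r addr0.
by rewrite lnM ?posrE//; ring.
Qed.

(** * Entropy of mixtures of centered Gaussians *)

Section GaussianMixture.
Context {R : realType}.

(* In nats, as a function of the variance. *)
Definition gauss_entropy (v : R) : R := 1 / 2 * ln (2 * pi * expR 1 * v).

Lemma gauss_entropyE v : 0 < v ->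
  gauss_entropy v = 1 / 2 * ln (2 * pi * v) + 1 / 2.
Proof.
move=> v0; have pv0 : 0 < 2 * pi * v by rewrite !mulr_gt0 ?pi_gt0.
rewrite /gauss_entropy.
have -> : 2 * pi * expR 1 * v = 2 * pi * v * expR 1 by ring.
by rewrite lnM ?posrE ?expR_gt0// expRK; lra.
Qed.

Lemma gauss_entropyD1 v : 0 < v -> gauss_entropy v = gauss_entropy 1 + 1 / 2 * ln v.
Proof.
move=> v0; rewrite !gauss_entropyE// mulr1 lnM ?posrE//; first lra.
by rewrite mulr_gt0 ?pi_gt0.
Qed.

(** The logarithm of a Gaussian density is quadratic, so only the mass and the second moment enter.
    Equal variances give the entropy, distinct ones the cross-entropy needed for Gibbs'
    inequality. *)
Lemma has_integral_gauss_ln_gauss (u v : R) : 0 < u -> 0 < v ->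
  has_integral (fun x => gauss 0 u x * ln (gauss 0 v x))
    (- (1 / 2 * ln (2 * pi * v) + u / (2 * v))).
Proof.
move=> u0 v0.
have := has_integralB _ _ _ _
  (has_integralZ (- (1 / 2 * ln (2 * pi * v))) _ _ (has_integral_gauss 0 u))
  (has_integralZ (2 * v)^-1 _ _ (gauss_second_moment u u0)).
rewrite mulr1 (mulrC _ u) -opprD; apply: has_integral_ext => x.
by rewrite ln_gauss// subr0; ring.
Qed.

Definition gauss_mixture n (w v : nat -> R) : R -> R :=
  fun x => \sum_(0 <= l < n) w l * gauss 0 (v l) x.

Variables (n : nat) (w v : nat -> R).
Hypothesis w0 : forall l, 0 <= w l.
Hypothesis v0 : forall l, 0 < v l.
Hypothesis w1 : \sum_(0 <= l < n) w l = 1.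

Local Notation psi := (gauss_mixture n w v).

Lemma has_integral_gauss_mixture : has_integral psi 1.
Proof.
rewrite -w1; apply: has_integral_sum => l _; rewrite -[w l]mulr1.
by apply: has_integral_ext (has_integralZ (w l) _ _ (has_integral_gauss 0 (v l)))
  => x; rewrite mulr1.
Qed.

Lemma gauss_mixture_gt0 x : 0 < psi x.
Proof.
rewrite /gauss_mixture lt_neqAle eq_sym psumr_neq0; last first.
  by move=> l _; rewrite mulr_ge0// ltW// gauss_gt0.
apply/andP; split; last first.
  by apply: sumr_ge0 => l _; rewrite mulr_ge0// ltW// gauss_gt0.
have : \sum_(0 <= l < n) w l != 0 by rewrite w1 oner_neq0.
rewrite psumr_neq0// => /hasP[l ln /= wl]; apply/hasP; exists l => //=.
by rewrite mulr_gt0// gauss_gt0.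
Qed.

Lemma measurable_gauss_mixture_ln :
  measurable_fun setT (fun x => psi x * ln (psi x)).
Proof.
have mpsi : measurable_fun setT psi.
  by apply: measurable_sum => l; apply: measurable_funM (measurable_gauss _ _).
by apply: measurable_funM => //; exact: measurableT_comp.
Qed.

(** Jensen's inequality for t ln t: the tangents are taken at [psi x], and their linear corrections
    cancel after weighting. *)
Lemma gauss_mixture_ln_le x :
  psi x * ln (psi x) <=
  \sum_(0 <= l < n) w l * (gauss 0 (v l) x * ln (gauss 0 (v l) x)).
Proof.
have := gauss_mixture_gt0 x; set y := psi x => y0.
have : \sum_(0 <= l < n) w l * (gauss 0 (v l) x * ln y + (gauss 0 (v l) x - y)) <=
   \sum_(0 <= l < n) w l * (gauss 0 (v l) x * ln (gauss 0 (v l) x)).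
  apply: ler_sum => l _; apply: ler_wpM2l => //.
  by apply: xlnx_tangent => //; rewrite ltW// gauss_gt0.
apply: le_trans; rewrite le_eqVlt; apply/orP; left; apply/eqP.
transitivity (\sum_(0 <= l < n) (w l * gauss 0 (v l) x * (ln y + 1) - w l * y)).
  rewrite sumrB -!mulr_suml w1 -/(gauss_mixture n w v x) -/y; ring.
by apply: eq_bigr => l _; ring.
Qed.

(** Each term of the mixture is at most the whole sum, and ln is increasing. Terms of weight zero
    contribute 0 to both sides. *)
Lemma gauss_mixture_ln_ge x :
  \sum_(0 <= l < n) (w l * ln (w l) * gauss 0 (v l) x +
     w l * (gauss 0 (v l) x * ln (gauss 0 (v l) x))) <=
  psi x * ln (psi x).
Proof.
rewrite {2}/gauss_mixture mulr_suml big_nat [leRHS]big_nat.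
apply: ler_sum => l /andP[_ ln]; have g0 := gauss_gt0 0 (v l) x (v0 l).
rewrite -xlnx_mul//; have := w0 l; rewrite le_eqVlt => /predU1P[<-|wl0].
  by rewrite !mul0r.
have wg0 : 0 < w l * gauss 0 (v l) x by rewrite mulr_gt0.
rewrite ler_pM2l// ler_ln ?posrE ?gauss_mixture_gt0//.
rewrite /gauss_mixture (bigD1_seq l) ?mem_index_iota ?iota_uniq//=.
by rewrite lerDl sumr_ge0// => i _; rewrite mulr_ge0// ltW// gauss_gt0.
Qed.

Lemma gauss_mixture_entropy : exists2 h,
  has_integral (fun x => psi x * ln (psi x)) (- (gauss_entropy 1 + h)) &
  [/\ \sum_(0 <= l < n) w l * (1 / 2 * ln (v l)) <= h,
      h <= \sum_(0 <= l < n) w l * (1 / 2 * ln (v l)) -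
           \sum_(0 <= l < n) w l * ln (w l) &
      h <= 1 / 2 * ln (\sum_(0 <= l < n) w l * v l)].
Proof.
have fI l : has_integral
    (fun x => w l * (gauss 0 (v l) x * ln (gauss 0 (v l) x)))
    (w l * - (gauss_entropy 1 + 1 / 2 * ln (v l))).
  rewrite -gauss_entropyD1// gauss_entropyE//; apply: has_integralZ.
  have {2}-> : 1 / 2 = v l / (2 * v l) :> R by field; exact: lt0r_neq0.
  exact: has_integral_gauss_ln_gauss.
have wI l : has_integral (fun x => w l * ln (w l) * gauss 0 (v l) x) (w l * ln (w l)).
  by have := has_integralZ (w l * ln (w l)) _ _ (has_integral_gauss 0 (v l)); rewrite mulr1.
have [c cI /andP[c1 c2]] := has_integral_squeeze _ _ _ _ _
  (has_integral_sum n _ _ (fun l _ => has_integralD _ _ _ _ (wI l) (fI l)))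
  (has_integral_sum n _ _ (fun l _ => fI l)) measurable_gauss_mixture_ln
  (fun x => introT andP (conj (gauss_mixture_ln_ge x) (gauss_mixture_ln_le x))).
have sE : \sum_(0 <= l < n) w l * - (gauss_entropy 1 + 1 / 2 * ln (v l)) =
    - gauss_entropy 1 - \sum_(0 <= l < n) w l * (1 / 2 * ln (v l)).
  transitivity (\sum_(0 <= l < n) (w l * - gauss_entropy 1 - w l * (1 / 2 * ln (v l)))).
    by apply: eq_bigr => l _; ring.
  by rewrite sumrB -mulr_suml w1 [1 * - _]mul1r.
move: c1 c2; rewrite big_split/= sE => c1 c2.
(* Here [- c] is the entropy of [psi] in nats, so the witness is its excess over the standard
   Gaussian. *)
exists (- c - gauss_entropy 1).
  by have -> : - (gauss_entropy 1 + (- c - gauss_entropy 1)) = c by ring.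
split; [lra | lra |].
set V := \sum_(0 <= l < n) w l * v l.
have V0 : 0 < V.
  rewrite lt_neqAle eq_sym psumr_neq0; last by move=> l _; rewrite mulr_ge0// ltW.
  rewrite sumr_ge0 ?andbT; last by move=> l _; rewrite mulr_ge0// ltW.
  have : \sum_(0 <= l < n) w l != 0 by rewrite w1 oner_neq0.
  rewrite psumr_neq0// => /hasP[l ln /= wl]; apply/hasP; exists l => //=.
  by rewrite mulr_gt0.
(* Gibbs' inequality against the Gaussian of variance [V]: the cross-entropy sees [psi] only through
   its mass and variance, and the correction [psi - gauss 0 V] integrates to 0. *)
have gI := has_integralD _ _ _ _
  (has_integral_sum n _ _ (fun l _ => has_integralZ (w l) _ _
     (has_integral_gauss_ln_gauss _ _ (v0 l) V0)))
  (has_integralB _ _ _ _ has_integral_gauss_mixture (has_integral_gauss 0 V)).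
have := le_has_integral _ _ _ _ gI cI.
have -> : \sum_(0 <= l < n) w l * - (1 / 2 * ln (2 * pi * V) + v l / (2 * V)) =
   - gauss_entropy V.
  transitivity (\sum_(0 <= l < n) (w l * - (1 / 2 * ln (2 * pi * V))
                 - w l * v l * (2 * V)^-1)).
    by apply: eq_bigr => l _; ring.
  rewrite sumrB -!mulr_suml w1 -/V gauss_entropyE//; field.
  by rewrite gt_eqF.
rewrite (gauss_entropyD1 V)// => H.
suff : - (gauss_entropy 1 + 1 / 2 * ln V) + (1 - 1) <= c by lra.
apply: H => x; have psi0 := gauss_mixture_gt0 x.
apply: le_trans (xlnx_tangent _ (gauss 0 V x) (ltW psi0) (gauss_gt0 _ _ _ V0)).
rewrite lerD2r /gauss_mixture mulr_suml le_eqVlt; apply/orP; left; apply/eqP.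
by apply: eq_bigr => l _; ring.
Qed.

(** The passage from nats to bits; the bounds on [h] stay in natural logarithms. *)
Lemma diff_entropy_gauss_mixture : exists2 h,
  diff_entropy psi - 1 / 2 * log2 (2 * pi * expR 1) = h / ln 2 &
  [/\ \sum_(0 <= l < n) w l * (1 / 2 * ln (v l)) <= h,
      h <= \sum_(0 <= l < n) w l * (1 / 2 * ln (v l)) -
           \sum_(0 <= l < n) w l * ln (w l) &
      h <= 1 / 2 * ln (\sum_(0 <= l < n) w l * v l)].
Proof.
have [h hI hb] := gauss_mixture_entropy; exists h => //.
have := has_integralZ (ln 2)^-1 _ _ hI.
have /funext -> : (fun x => (ln 2)^-1 * (psi x * ln (psi x))) =1
  (fun x => psi x * log2 (psi x)) by move=> x; rewrite /log2; ring.
rewrite /diff_entropy => -[_ ->]; rewrite /gauss_entropy /log2 mulr1; ring.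
Qed.

End GaussianMixture.

(** * Discrete entropy bounded by Gaussian entropy *)

Section DiscreteEntropy.
Context {R : realType}.

(** The fundamental theorem of calculus on the closed interval; dropping the right endpoint does not
    change the integral. *)
Lemma has_integral_poly_itv (P : {poly R}) (a b : R) : a < b ->
  has_integral (fun x => (a <= x < b)%R%:R * P^`().[x]) (P.[b] - P.[a]).
Proof.
move=> ab; pose f x := P^`().[x].
have fP : \int[lebesgue_measure]_(x in `[a, b]%classic) f x = P.[b] - P.[a].
  rewrite /Rintegral (@continuous_FTC2 _ f (horner P)) -?EFinB//.
  - exact/continuous_subspaceT/continuous_horner.
  - split.
    + by move=> x _; have [] := is_derive_poly P x.
    + exact/cvg_at_right_filter/continuous_horner.
    + exact/cvg_at_left_filter/continuous_horner.
  - by move=> x _; rewrite -derivE.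
have abS : (`[a, b[ `<=` `[a, b])%classic by apply: subset_itvl; rewrite bnd_simp.
have fcc := @continuous_compact_integrable R f `[a, b]%classic
  (@segment_compact _ a b) (continuous_subspaceT (@continuous_horner _ P^`())).
have fi : integrable lebesgue_measure `[a, b[%classic (EFin \o f).
  by refine (integrableS _ _ _ fcc) => //; exact: measurable_itv.
apply: (has_integral_ext (f \_ `[a, b[%classic)%R).
  move=> x; rewrite /patch mem_setE in_itv/=.
  by case: ifP => _; rewrite ?mul1r ?mul0r.
split; last by rewrite -Rintegral_mkcond Rintegral_itv_bndo_bndc.
rewrite -restrict_EFin; apply: (iffLR (integrable_mkcond _ _)) fi.
exact: measurable_itv.
Qed.

(* The cells are half-open so that their indicators telescope. *)
Lemma sum_unit_cells_le1 n (x : R) :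
  \sum_(0 <= l < n) (l%:R - 1 / 2 <= x < l%:R + 1 / 2)%R%:R <= 1 :> R.
Proof.
pose t l : R := - (l%:R - 1 / 2 <= x)%R%:R.
have tE l : (l%:R - 1 / 2 <= x < l%:R + 1 / 2)%R%:R = t l.+1 - t l.
  rewrite /t -[l.+1%:R]natr1; have -> : l%:R + 1 - 1 / 2 = l%:R + 1 / 2 :> R by lra.
  case: (leP (l%:R - 1 / 2) x); case: (leP (l%:R + 1 / 2) x) => //=; lra.
under eq_bigr do rewrite tE.
rewrite telescope_sumr// /t; do 2 case: (_ <= x) => /=; lra.
Qed.

(* The parenthesized factor integrates to 1 over the unit interval centered at c,
   as the mean of (x - c)^2 there is 1/12; the integral of this inequality is
   Jensen's inequality for the Gaussian mass of that interval. *)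
Lemma gauss_unit_cell_tangent (m V c x : R) : 0 < V ->
  gauss m V c * expR (- (24 * V)^-1) *
    (1 - (2 * (c - m) * (x - c) + ((x - c) ^+ 2 - 1 / 12)) / (2 * V)) <=
  gauss m V x.
Proof.
move=> V0; rewrite !gaussE// -!mulrA ler_pM2l; last first.
  by rewrite invr_gt0 sqrtr_gt0 pmulrn_lgt0// mulr_gt0// pi_gt0.
rewrite mulrA -expRD; set e := (X in expR X); set d := (X in 1 - X).
have -> : - (x - m) ^+ 2 / (V *+ 2) = e - d by rewrite /e /d; field; lra.
by rewrite expRD ler_pM2l ?expR_gt0// expR_ge1Dx.
Qed.

(** Each summand is the integral over one unit cell of a minorant of the density. The cells are
    disjoint, so the total is at most the mass of the Gaussian. *)
Lemma sum_gauss_unit_cell_le1 n (m V : R) : 0 < V ->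
  \sum_(0 <= l < n) gauss m V l%:R * expR (- (24 * V)^-1) <= 1.
Proof.
move=> V0; pose c l : R := gauss m V l%:R * expR (- (24 * V)^-1).
pose p l x := 1 - (2 * (l%:R - m) * (x - l%:R) + ((x - l%:R) ^+ 2 - 1 / 12)) / (2 * V).
pose cell l (x : R) : R := (l%:R - 1 / 2 <= x < l%:R + 1 / 2)%R%:R.
have pI l : has_integral (fun x => c l * (cell l x * p l x)) (c l).
  rewrite -[c l in X in has_integral _ X]mulr1; apply: has_integralZ.
  pose Y : {poly R} := 'X - l%:R%:P.
  (* An antiderivative of [p l] in powers of [x - l%:R]. Between the cell's endpoints the even term
     cancels, as do the contributions of the cubic term and of the last linear one, leaving 1. *)
  pose P := Y - ((l%:R - m) / (2 * V)) *: Y ^+ 2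
              - (6 * V)^-1 *: Y ^+ 3 + (24 * V)^-1 *: Y.
  have PE x : P.[x] = (x - l%:R) - ((l%:R - m) / (2 * V)) * (x - l%:R) ^+ 2
              - (6 * V)^-1 * (x - l%:R) ^+ 3 + (24 * V)^-1 * (x - l%:R).
    by rewrite /P /Y !hornerE.
  have P'E x : P^`().[x] = p l x.
    rewrite /P /Y !poly.derivE/= !hornerE /p /=; field; lra.
  have := has_integral_poly_itv P (l%:R - 1 / 2) (l%:R + 1 / 2) ltac:(lra).
  have -> : P.[l%:R + 1 / 2] - P.[l%:R - 1 / 2] = 1 by rewrite !PE; field; lra.
  by apply: has_integral_ext => x; rewrite P'E.
apply: (le_has_integral _ _ _ _ (has_integral_sum n _ _ (fun l _ => pI l))
  (has_integral_gauss m V)) => x.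
rewrite -[leRHS]mul1r.
apply: le_trans (ler_wpM2r (ltW (gauss_gt0 _ _ _ V0)) (sum_unit_cells_le1 n x)).
rewrite mulr_suml; apply: ler_sum => l _; rewrite mulrCA.
by apply: ler_wpM2l => //; exact: gauss_unit_cell_tangent.
Qed.

(** Gibbs' inequality against the subprobability [r]. The factor [expR (- (24 * V)^-1)] in [r] costs
    1/12 divided by [2 * V], which is exactly the effect of adding 1/12 to the second moment about
    [m]. *)
Lemma discrete_entropy_le n (w : nat -> R) (m V : R) :
  (forall l, 0 <= w l) -> \sum_(0 <= l < n) w l = 1 -> 0 < V ->
  \sum_(0 <= l < n) w l * (l%:R - m) ^+ 2 + 1 / 12 <= V ->
  - \sum_(0 <= l < n) w l * ln (w l) <= gauss_entropy V.
Proof.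
move=> w0 w1 V0 wV; pose r l := gauss m V l%:R * expR (- (24 * V)^-1).
have r0 l : 0 < r l by rewrite mulr_gt0 ?gauss_gt0 ?expR_gt0.
have r1 := sum_gauss_unit_cell_le1 n m V V0; rewrite -/r in r1.
have : \sum_(0 <= l < n) (w l * ln (r l) + (w l - r l)) <=
    \sum_(0 <= l < n) w l * ln (w l).
  by apply: ler_sum => l _; exact: xlnx_tangent.
rewrite big_split/= sumrB w1.
have -> : \sum_(0 <= l < n) w l * ln (r l) =
    - (1 / 2 * ln (2 * pi * V)) -
    (\sum_(0 <= l < n) w l * (l%:R - m) ^+ 2 + 1 / 12) / (2 * V).
  transitivity (\sum_(0 <= l < n)
     (w l * (- (1 / 2 * ln (2 * pi * V)) - (24 * V)^-1) -
      w l * (l%:R - m) ^+ 2 * (2 * V)^-1)).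
    apply: eq_bigr => l _.
    by rewrite /r lnM ?posrE ?gauss_gt0 ?expR_gt0// expRK ln_gauss//; ring.
  by rewrite sumrB -!mulr_suml w1; field; lra.
rewrite gauss_entropyE//.
have : (\sum_(0 <= l < n) w l * (l%:R - m) ^+ 2 + 1 / 12) / (2 * V) <= 1 / 2.
  by rewrite ler_pdivrMr ?mulr_gt0//; lra.
have : \sum_(0 <= l < n) r l <= 1 by [].
by lra.
Qed.

End DiscreteEntropy.

(** * Moments and entropy of binomial weights *)

Section Binomial.
Context {R : realType}.

Definition binomial_weight (a : R) (k l : nat) : R :=
  'C(k, l)%:R * a ^+ l * (1 - a) ^+ (k - l).

Lemma binomial_weight_ge0 a k l : 0 <= a <= 1 -> 0 <= binomial_weight a k l.
Proof.
by move=> /andP[a0 a1]; rewrite !mulr_ge0// ?exprn_ge0// subr_ge0.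
Qed.

(** Pascal's rule, read as conditioning on the outcome of one trial. It drives the inductions for
    the mass and the first two moments. *)
Lemma sum_binomial_weightS a k (F : nat -> R) :
  \sum_(0 <= l < k.+2) binomial_weight a k.+1 l * F l =
  a * (\sum_(0 <= l < k.+1) binomial_weight a k l * F l.+1) +
  (1 - a) * (\sum_(0 <= l < k.+1) binomial_weight a k l * F l).
Proof.
have -> : \sum_(0 <= l < k.+1) binomial_weight a k l * F l =
    \sum_(0 <= l < k.+2) binomial_weight a k l * F l.
  by rewrite [RHS]big_nat_recr//= /binomial_weight bin_small// !mul0r addr0.
rewrite big_nat_recl// [in RHS](big_nat_recl k.+1)//=.
rewrite !mulrDr !mulr_sumr addrCA -big_split/=; congr (_ + _).
  by rewrite /binomial_weight !bin0 !subn0 exprS; ring.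
apply: eq_big_nat => l /andP[_]; rewrite ltnS => lk.
rewrite /binomial_weight binS natrD subSS exprS.
(* A factor [1 - a] can be split off the power only for [l < k]; at [l = k] the coefficient
   ['C(k, l.+1)] vanishes. *)
have [lk'|kl] := ltnP l k; last by rewrite bin_small ?ltnS//; ring.
by rewrite -(subnSK lk') exprS; ring.
Qed.

Lemma sum_binomial_weight a k : \sum_(0 <= l < k.+1) binomial_weight a k l = 1.
Proof.
rewrite (eq_bigr (fun l => binomial_weight a k l * 1)); last by move=> *; rewrite mulr1.
elim: k => [|k IH]; last by rewrite sum_binomial_weightS !IH; ring.
by rewrite big_nat1 /binomial_weight bin0; ring.
Qed.

Lemma binomial_mean a k :
  \sum_(0 <= l < k.+1) binomial_weight a k l * l%:R = k%:R * a.
Proof.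
elim: k => [|k IH]; first by rewrite big_nat1; ring.
rewrite sum_binomial_weightS IH.
rewrite (eq_bigr (fun l => binomial_weight a k l * l%:R + binomial_weight a k l)).
  by rewrite big_split/= IH sum_binomial_weight -(natr1 k); ring.
by move=> l _; rewrite -(natr1 l); ring.
Qed.

Lemma binomial_second_moment a k :
  \sum_(0 <= l < k.+1) binomial_weight a k l * l%:R ^+ 2 =
  k%:R * a * (1 - a) + (k%:R * a) ^+ 2.
Proof.
elim: k => [|k IH]; first by rewrite big_nat1; ring.
rewrite sum_binomial_weightS IH.
rewrite (eq_bigr (fun l => binomial_weight a k l * l%:R ^+ 2 +
  2 * (binomial_weight a k l * l%:R) + binomial_weight a k l)).
  rewrite 2!big_split/= -mulr_sumr IH sum_binomial_weight binomial_mean.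
  by rewrite -(natr1 k); ring.
by move=> l _; rewrite -(natr1 l); ring.
Qed.

Lemma binomial_variance a k :
  \sum_(0 <= l < k.+1) binomial_weight a k l * (l%:R - k%:R * a) ^+ 2 =
  k%:R * a * (1 - a).
Proof.
rewrite (eq_bigr (fun l => binomial_weight a k l * l%:R ^+ 2 -
  2 * k%:R * a * (binomial_weight a k l * l%:R) +
  (k%:R * a) ^+ 2 * binomial_weight a k l)); last by move=> l _; ring.
rewrite big_split/= sumrB -!mulr_sumr sum_binomial_weight binomial_mean.
by rewrite binomial_second_moment; ring.
Qed.

(** The variance [k%:R * a * (1 - a)] is at most [a * k%:R]. *)
Lemma binomial_entropy_le_gauss a k : 0 < a <= 1 ->
  - \sum_(0 <= l < k.+1) binomial_weight a k l * ln (binomial_weight a k l) <=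
  gauss_entropy (a * k%:R + 1 / 12).
Proof.
move=> /andP[a0 a1]; have ka0 : 0 <= a * k%:R by rewrite mulr_ge0// ltW.
apply: (discrete_entropy_le _ _ (k%:R * a)).
- by move=> l; rewrite binomial_weight_ge0// a1 ltW.
- exact: sum_binomial_weight.
- lra.
- by rewrite binomial_variance; nra.
Qed.

(** The number of successes is a function of the k trials, so its entropy is at most theirs. In the
    computation, the binomial mean turns the averaged log-weight of a single outcome sequence into k
    Bernoulli entropies. *)
Lemma binomial_entropy_le_bernoulli a k : 0 < a <= 1 ->
  - \sum_(0 <= l < k.+1) binomial_weight a k l * ln (binomial_weight a k l) <=
  k%:R * (- (a * ln a) - (1 - a) * ln (1 - a)).
Proof.
move=> /andP[a0 a1].
(* With [ln 0 = 0] the power rule survives at 0, which covers [a = 1]. *)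
have lnX0 n : ln ((0 : R) ^+ n) = n%:R * ln 0.
  by case: n => [|n]; rewrite ?expr0 ?ln1 ?mul0r// exprS mul0r ln0// mulr0.
have lnX (x : R) n : 0 <= x -> ln (x ^+ n) = n%:R * ln x.
  rewrite le_eqVlt => /predU1P[<-//|x0].
  by rewrite lnXn// mulr_natl.
have : \sum_(0 <= l < k.+1) (ln (1 - a) * k%:R * binomial_weight a k l +
     (ln a - ln (1 - a)) * (binomial_weight a k l * l%:R)) <=
   \sum_(0 <= l < k.+1) binomial_weight a k l * ln (binomial_weight a k l).
  rewrite big_nat [leRHS]big_nat; apply: ler_sum => l; rewrite ltnS => /= lk.
  have w0 : 0 <= binomial_weight a k l by rewrite binomial_weight_ge0// a1 ltW.
  move: (w0); rewrite le_eqVlt => /predU1P[<-|wp]; first by rewrite !(mulr0, mul0r) addr0.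
  have b0 : 0 <= 1 - a by lra.
  (* Dropping the factor 'C(k, l) >= 1 leaves the k-fold Bernoulli weight. *)
  have C1 : 1 <= 'C(k, l)%:R :> R by rewrite ler1n bin_gt0.
  have y0 : 0 < (1 - a) ^+ (k - l).
    rewrite lt_neqAle exprn_ge0// andbT eq_sym; apply/eqP => y0.
    by move: wp; rewrite /binomial_weight y0 mulr0 ltxx.
  have x0 : 0 < a ^+ l by rewrite exprn_gt0.
  have C0 : 0 < 'C(k, l)%:R :> R by lra.
  have -> : ln (1 - a) * k%:R * binomial_weight a k l +
      (ln a - ln (1 - a)) * (binomial_weight a k l * l%:R) =
      binomial_weight a k l * (l%:R * ln a + (k - l)%:R * ln (1 - a)).
    by rewrite natrB//; ring.
  rewrite ler_pM2l// /binomial_weight lnM ?posrE ?mulr_gt0// lnM ?posrE//.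
  by rewrite (lnX _ _ b0) (lnX _ _ (ltW a0)) -addrA lerDr ln_ge0.
rewrite big_split/= -!mulr_sumr sum_binomial_weight binomial_mean; lra.
Qed.

End Binomial.

(** In the induction, the product of [1 + n%:R * x] and [1 + x] exceeds [1 + n.+1%:R * x] by
    [n%:R * x ^+ 2]. *)
Lemma ln_1DMn_le {R : realType} (x : R) n : 0 <= x ->
  ln (1 + n%:R * x) <= n%:R * ln (1 + x).
Proof.
move=> x0; elim: n => [|n IH]; first by rewrite !mul0r addr0 ln1.
rewrite -natr1 [leRHS]mulrDl mul1r; apply: le_trans (lerD IH (lexx _)).
have nx0 : 0 <= n%:R * x by rewrite mulr_ge0.
have nxx0 : 0 <= n%:R * x * x by rewrite mulr_ge0.
by rewrite -lnM ?posrE ?ler_ln ?posrE; nra.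
Qed.

(** * Entropy excess of psi1 and psi2, and the resulting quotients *)

Section Psi.
Context {R : realType}.

(** This makes every bound for [g2] the one-trial case of a bound for [psi1]. *)
Lemma psi2E (beta gamma : R) : psi2 beta gamma = psi1 1 beta gamma.
Proof.
apply/funext => x; rewrite /psi1 /psi2 big_nat_recr//= big_nat1.
by rewrite !mul0r addr0 !mul1r subn0 subnn !expr1 expr0 mulr1 addrC.
Qed.

Lemma psi1_entropy_excess (k : nat) (beta gamma : R) :
  (0 < k)%N -> 0 < beta -> 0 < gamma <= 1 ->
  let s := 1 / 2 * gamma * k%:R * ln (1 + beta ^+ 2 / gamma) in
  exists2 h,
    diff_entropy (psi1 k beta gamma) - 1 / 2 * log2 (2 * pi * expR 1) = h / ln 2 &
    [/\ 0 < h, h <= 1 / 2 * ln (1 + k%:R * beta ^+ 2),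
        h <= s + gauss_entropy (gamma * k%:R + 1 / 12) &
        h <= s + k%:R * (- (gamma * ln gamma) - (1 - gamma) * ln (1 - gamma))].
Proof.
move=> k0 beta0 gamma01 s; have /andP[gamma0 gamma1] := gamma01.
pose x := beta ^+ 2 / gamma; have x0 : 0 < x by rewrite divr_gt0 ?exprn_gt0.
pose w := binomial_weight gamma k; pose v l : R := 1 + l%:R * x.
have w0 l : 0 <= w l by rewrite binomial_weight_ge0// gamma1 ltW.
have v1 l : 1 <= v l by rewrite lerDl mulr_ge0// ltW.
have v0 l : 0 < v l by exact: lt_le_trans (v1 l).
have -> : psi1 k beta gamma = gauss_mixture k.+1 w v.
  by apply/funext => y; apply: eq_bigr => l _; rewrite /v /x mulrA.
have [h hE [h1 h2 h3]] :=
  diff_entropy_gauss_mixture _ _ _ w0 v0 (sum_binomial_weight gamma k).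
exists h => //.
have wk : 0 < w k by rewrite /w /binomial_weight binn subnn expr0 mulr1 mul1r exprn_gt0.
(* Strictness comes from the last component alone: its weight is [gamma ^+ k > 0] and its variance
   exceeds 1. *)
have h0 : 0 < h.
  apply: lt_le_trans h1; rewrite big_nat_recr//=.
  apply: ltr_wpDl; last first.
    have vk : 1 < v k by rewrite ltrDl mulr_gt0// ltr0n.
    by apply: mulr_gt0 => //; apply: mulr_gt0; [lra | exact: ln_gt0].
  have lnv l : 0 <= ln (v l) by exact: ln_ge0.
  by apply: sumr_ge0 => l _; apply: mulr_ge0 => //; apply: mulr_ge0 => //; lra.
have mean : \sum_(0 <= l < k.+1) w l * v l = 1 + k%:R * beta ^+ 2.
  rewrite (eq_bigr (fun l => w l + x * (w l * l%:R))); last by move=> l _; rewrite /v; ring.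
  rewrite big_split/= -mulr_sumr sum_binomial_weight binomial_mean /x.
  by field; rewrite gt_eqF.
(* Bernoulli's inequality makes each log-variance linear in [l], and the binomial mean then
   evaluates the sum. *)
have hs : \sum_(0 <= l < k.+1) w l * (1 / 2 * ln (v l)) <= s.
  have -> : s = \sum_(0 <= l < k.+1) (1 / 2 * ln (1 + x)) * (w l * l%:R).
    by rewrite -mulr_sumr binomial_mean /s -/x; ring.
  apply: ler_sum => l _; rewrite [leRHS]mulrCA; apply: ler_wpM2l => //.
  rewrite -[leRHS]mulrA; apply: ler_wpM2l; first lra.
  by rewrite [leRHS]mulrC; apply: ln_1DMn_le; exact: ltW.
have e1 := binomial_entropy_le_gauss gamma k gamma01.
have e2 := binomial_entropy_le_bernoulli gamma k gamma01.
rewrite -mean; split=> //; rewrite -/w in e1 e2; lra.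
Qed.

Lemma ler_div_antitone (n d e : R) : 0 <= n -> 0 < d -> d <= e -> n / e <= n / d.
Proof.
move=> n0 d0 de; apply: ler_wpM2l => //.
by rewrite lef_pV2// posrE// (lt_le_trans d0).
Qed.

Lemma log2_nat_ge1 (n : nat) : (2 <= n)%N -> 0 <= log2 n%:R - 1 :> R.
Proof.
move=> n2; have l2 : 0 < ln 2 :> R by rewrite ln_gt0// ltr1n.
have n0 : (0 : R) < n%:R by rewrite ltr0n; exact: leq_trans n2.
by rewrite subr_ge0 /log2 ler_pdivlMr// mul1r ler_ln ?posrE// ler_nat.
Qed.

(** The numerator [n] is left free so that the lemma serves both [g1] and, with [k = 1], [g2]. *)
Lemma psi1_quotient_bounds (k : nat) (beta gamma n : R) :
  (0 < k)%N -> 0 < beta -> 0 < gamma <= 1 -> 0 <= n ->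
  let q := n / (diff_entropy (psi1 k beta gamma) - 1 / 2 * log2 (2 * pi * expR 1)) in
  [/\ n / (1 / 2 * log2 (1 + k%:R * beta ^+ 2)) <= q,
      n / (1 / 2 * gamma * k%:R * log2 (1 + beta ^+ 2 / gamma) +
           1 / 2 * log2 (2 * pi * expR 1 * (gamma * k%:R + 1 / 12))) <= q &
      n / (1 / 2 * gamma * k%:R * log2 (1 + beta ^+ 2 / gamma) +
           k%:R * H_binary gamma) <= q].
Proof.
move=> k0 beta0 gamma01 n0 q; rewrite /q.
have l2 : 0 < ln 2 :> R by rewrite ln_gt0// ltr1n.
have [h -> [h0 h1 h2 h3]] := psi1_entropy_excess k beta gamma k0 beta0 gamma01.
split; (apply: ler_div_antitone; [done | by rewrite divr_gt0 |]).
- by rewrite /log2 mulrA ler_pM2r ?invr_gt0.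
- rewrite ler_pdivrMr// /log2; apply: le_trans h2 _.
  rewrite le_eqVlt /gauss_entropy; apply/orP; left; apply/eqP; field.
  by rewrite !gt_eqF//; case/andP: gamma01.
- rewrite ler_pdivrMr// /H_binary /log2; apply: le_trans h3 _.
  rewrite le_eqVlt; apply/orP; left; apply/eqP; field.
  by rewrite !gt_eqF//; case/andP: gamma01.
Qed.

End Psi.

Theorem corollary2 (R : realType) (p k : nat) (beta_min gamma : R)
  (hk : (1 <= k)%N) (hkp : (k < p)%N)
  (hbeta : 0 < beta_min) (hgamma0 : 0 < gamma) (hgamma1 : gamma <= 1) :

  (g1 p k beta_min gamma >=
     (log2 'C(p, k)%:R - 1) / (1 / 2 * log2 (1 + k%:R * beta_min ^+ 2))
   /\
   g2 p k beta_min gamma >=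
     (log2 (p - k + 1)%N%:R - 1) / (1 / 2 * log2 (1 + beta_min ^+ 2)))
  /\

  (forall tau : R, gamma * k%:R = tau ->
     let C := 1 / 2 * log2 (2 * pi * expR 1 * (tau + 1 / 12)) in
     g1 p k beta_min gamma >=
       (log2 'C(p, k)%:R - 1)
       / (1 / 2 * tau * log2 (1 + k%:R * beta_min ^+ 2 / tau) + C)
     /\
     g2 p k beta_min gamma >=
       (log2 (p - k + 1)%N%:R - 1)
       / (1 / 2 * (tau / k%:R) * log2 (1 + k%:R * beta_min ^+ 2 / tau)
          + H_binary (tau / k%:R)))
  /\

  (gamma * k%:R <= 1 ->
     g1 p k beta_min gamma >=
       (log2 'C(p, k)%:R - 1)
       / (1 / 2 * gamma * k%:R * log2 (1 + beta_min ^+ 2 / gamma)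
          + k%:R * H_binary gamma)
     /\
     g2 p k beta_min gamma >=
       (log2 (p - k + 1)%N%:R - 1)
       / (1 / 2 * gamma * log2 (1 + beta_min ^+ 2 / gamma)
          + H_binary gamma)).
Proof.
have gamma01 : 0 < gamma <= 1 by rewrite hgamma0.
(* By Pascal's rule it is a sum of two positive binomials. Together with [pk] this makes both
   numerators nonnegative. *)
have Cpk : (2 <= 'C(p, k))%N.
  case: p k hk hkp => [|p'] [|k']// _ kp; rewrite binS.
  by apply: (@leq_add 1 1); rewrite bin_gt0// ltnW.
have pk : (2 <= p - k + 1)%N by rewrite addn1 ltnS subn_gt0.
have [a1 b1 c1] := psi1_quotient_bounds k _ gamma _ hk hbeta gamma01
  (@log2_nat_ge1 R _ Cpk).
have := psi1_quotient_bounds 1 _ gamma _ isT hbeta gamma01 (@log2_nat_ge1 R _ pk).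
rewrite /= -psi2E [1 * beta_min ^+ 2]mul1r [1 * H_binary _]mul1r mulr1.
move=> -[a2 _ c2]; split; first by split.
split=> [tau tauE|_]; last by split.
have k0 : (k%:R : R) != 0 by rewrite pnatr_eq0 -lt0n.
(* Substituting [tau = gamma * k%:R] turns the bounds in [tau] into those already obtained in
   [gamma]. *)
have -> : tau / k%:R = gamma by rewrite -tauE mulfK.
have -> : k%:R * beta_min ^+ 2 / tau = beta_min ^+ 2 / gamma.
  by rewrite -tauE; field; rewrite k0 gt_eqF.
by rewrite -tauE [1 / 2 * (gamma * k%:R)]mulrA; split.
Qed.
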